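(* Let $(G_\lambda)_{\lambda\in\Lambda}$ and $(B_\lambda)_{\lambda\in\Lambda}$ be families of groups indexed by the same set $\Lambda$, let $G=\prod^*_{\lambda\in\Lambda}G_\lambda$ and $B=\prod^*_{\lambda\in\Lambda}B_\lambda$ be their free products, and let $\Theta\colon G\to B$ be a group homomorphism such that $G_\lambda\Theta=B_\lambda$ for all $\lambda\in\Lambda$. Let $H\subseteq G$ be a subgroup such that $H\Theta=B$. Then there exist, for each $\lambda\in\Lambda$, a subgroup $H_\lambda\subseteq H$, a free subgroup $F_\lambda\subseteq H_\lambda$, and a set $X_\lambda\subseteq G$ containing exactly one element of each double coset $G_\lambda xH$ ($x\in G$), such that: (i) $H=\prod^*_{\lambda\in\Lambda}H_\lambda$; (ii) $H_\lambda\Theta=B_\lambda$ for every $\lambda\in\Lambda$; (iii) $H_\lambda=\Bigl(\prod^*_{x\in X_\lambda}(H\cap G_\lambda^{x})\Bigr)\ast F_\lambda$ for every $\lambda\in\Lambda$; (iv) $x\Theta=1$ for every $\lambda\in\Lambda$ and every $x\in X_\lambda$; (v) for every $\lambda\in\Lambda$, the double coset $G_\lambda H$ is represented by $1$, i.e. $1\in X_\lambda$.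
   Context: Homomorphisms are written on the right: $g\Theta$ is the image of $g$, and $K\Theta$ is the image of a subgroup $K$. The symbols $\prod^*$ and $\ast$ denote free products of groups (coproducts in the category of groups); the factors $G_\lambda$ and $B_\lambda$ are regarded as subgroups of $G$ and $B$ in the canonical way. For a subgroup $K$ of $G$ and $x\in G$, $K^x:=x^{-1}Kx$. The decompositions of $H$ and $H_\lambda$ are internal: for a group $K$ with subgroups $K_i$, $K=\prod^*_i K_i$ means that the homomorphism from the free product of the $K_i$ to $K$ induced by the inclusions $K_i\hookrightarrow K$ is an isomorphism. Trivial factors are allowed, and the trivial group is considered free. *)

(* Defs.v *)
From HB Require Import structures.
From mathcomp Require Import all_boot.
From mathcomp Require Import boolp classical_sets.

Set Implicit Arguments.
Unset Strict Implicit.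
Unset Printing Implicit Defensive.

Local Open Scope classical_set_scope.
Local Open Scope group_scope.

#[local] Obligation Tactic := idtac.

Notation ghom G H := (UMagmaMorphism.type G H).

Record subgroup (G : groupType) := Subgroup {
  carrier :> set G;
  carrier1 : carrier 1;
  carrierM : forall x y, carrier x -> carrier y -> carrier (x * y);
  carrierV : forall x, carrier x -> carrier x^-1 }.

Definition sub_of (G : groupType) (K : subgroup G) : Type := set_type K.

Section SubOf.
Variables (G : groupType) (K : subgroup G).

HB.instance Definition _ := SubChoice.copy (sub_of K) (set_type K).

Fact sub_of_closed : group_closed (fun x => x \in carrier K).
Proof.
split=> [|x y]; first by apply/mem_set/carrier1.
move=> /set_mem Kx /set_mem Ky.
by apply/mem_set/carrierM => //; apply: carrierV.
Qed.

HB.instance Definition _ :=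
  SubChoice_isSubGroup.Build G (fun x => x \in carrier K) (sub_of K) sub_of_closed.

End SubOf.

Section Subgroups.
Variable G : groupType.

Program Definition image_group (A : groupType) (f : ghom A G) : subgroup G :=
  @Subgroup G (range f) _ _ _.
Next Obligation. by move=> A f; exists 1; rewrite ?gmulf1. Qed.
Next Obligation. by move=> A f _ _ [a _ <-] [b _ <-]; exists (a * b); rewrite ?gmulfM. Qed.
Next Obligation. by move=> A f _ [a _ <-]; exists a^-1; rewrite ?gmulfV. Qed.

(* [k ^ x] is [x^-1 * (k * x)]. *)
Program Definition conj_group (K : subgroup G) (x : G) : subgroup G :=
  @Subgroup G [set k ^ x | k in K] _ _ _.
Next Obligation. by move=> K x; exists 1; [exact: carrier1 | rewrite conj1g]. Qed.
Next Obligation.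
by move=> K x _ _ [a Ka <-] [b Kb <-]; exists (a * b); [exact: carrierM | rewrite conjMg].
Qed.
Next Obligation.
by move=> K x _ [a Ka <-]; exists a^-1; [exact: carrierV | rewrite conjVg].
Qed.

Program Definition meet_group (K L : subgroup G) : subgroup G :=
  @Subgroup G (K `&` L) _ _ _.
Next Obligation. by move=> K L; split; exact: carrier1. Qed.
Next Obligation.
by move=> K L x y [Kx Lx] [Ky Ly]; split; exact: carrierM.
Qed.
Next Obligation. by move=> K L x [Kx Lx]; split; exact: carrierV. Qed.

Definition double_coset (K : set G) (x : G) (L : set G) : set G :=
  [set k * x * l | k in K & l in L].

End Subgroups.

(* [P] with the maps [j i] is the coproduct of the [K_ i] in the category of
   groups. *)
Definition is_free_product (I : Type) (K_ : I -> groupType) (P : groupType)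
    (j : forall i, ghom (K_ i) P) : Prop :=
  forall (T : groupType) (f : forall i, ghom (K_ i) T),
    exists phi : ghom P T, (forall i k, phi (j i k) = f i k) /\
      forall psi : ghom P T, (forall i k, psi (j i k) = f i k) -> psi =1 phi.

(* The homomorphism from the free product of the subgroups [K_ i] to [K] that is
   induced by the inclusions is an isomorphism; the equation for [phi] forces
   each [K_ i] to lie in [K]. *)
Definition is_internal_free_product (G : groupType) (K : subgroup G)
    (I : Type) (K_ : I -> subgroup G) : Prop :=
  exists (P : groupType) (j : forall i, ghom (sub_of (K_ i)) P),
    is_free_product j /\
    exists phi : ghom P (sub_of K),
      (forall i k, val (phi (j i k)) = val k) /\ bijective phi.

Definition is_internal_free_product2 (G : groupType) (K A B : subgroup G) :=
  is_internal_free_product K (fun b : bool => if b then A else B).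

(* Freeness through the universal property of a basis [S]. *)
Definition is_free_group (F : groupType) : Prop :=
  exists S : set F, forall (T : groupType) (f : S -> T),
    exists phi : ghom F T, (forall s : S, phi (val s) = f s) /\
      forall psi : ghom F T, (forall s : S, psi (val s) = f s) -> psi =1 phi.

(* Main.v *)
From HB Require Import structures.
Require Import Defs.
From mathcomp Require Import all_boot generic_quotient.
From mathcomp Require Import boolp classical_sets.

Set Implicit Arguments.
Unset Strict Implicit.
Unset Printing Implicit Defensive.

Local Open Scope classical_set_scope.
Local Open Scope group_scope.

#[local] Obligation Tactic := idtac.

(** [G] acts on the cosets [x H]; arrows of the action groupoid are pairs
  [(x, y)] of elements of [G] up to simultaneous right multiplication by [H],
  and [(x, a x)] with [a] in the factor [G_l] generates the subgroupoid of
  colour [l]. Suppose that a simply connected subgroupoid [D] is killed by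
  [Theta] and is connected. Adding [D] to the subgroupoid of colour [l] and
  taking the vertex group at [1] gives [H_l]; [H] is the free product of the
  [H_l] as soon as every edge of [D] can be traded for a path of one colour and
  earlier edges of [D]. By Zorn's lemma there is a maximal such [D]. If it were
  not connected, [G] being generated by its factors and [B] being the free
  product of their images would yield a one-coloured path, killed by [Theta],
  between two components of [D] (Stallings' binding tie), and [D] could be
  enlarged by it. The decomposition of [H_l] is Kurosh's theorem for [H_l] in
  [G]: by malnormality of the [H_l] in [H], all intersections with conjugates
  of factors are trivial except those with the conjugates of [G_l] by elements
  linked to [1] in colour [l]. Such an element has its image under [Theta] in
  [B_l], which is the image of [G_l], so it can be multiplied on the left by an
  element of [G_l] to have trivial image. *)

(** * Unrestricted wreath products *)

Section Wreath.
Variables (P T : groupType).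

Definition wreath : Type := ((P -> T) * P)%type.

HB.instance Definition _ := gen_eqMixin wreath.
HB.instance Definition _ := gen_choiceMixin wreath.

(** The pair [(f, p)] stands for the permutation of [T * P] that sends [(t, g)] to
    [(f g * t, p * g)]; the product is composition. *)
Definition wreath_mul (u v : wreath) : wreath :=
  (fun g => u.1 (v.2 * g) * v.1 g, u.2 * v.2).
Definition wreath_one : wreath := (fun=> 1, 1).
Definition wreath_inv (u : wreath) : wreath :=
  (fun g => (u.1 (u.2^-1 * g))^-1, u.2^-1).

Lemma wreath_mulA : associative wreath_mul.
Proof.
move=> u v w; rewrite /wreath_mul /= mulgA; congr pair.
by apply: funext => g; rewrite !mulgA.
Qed.

Lemma wreath_mul1g : left_id wreath_one wreath_mul.
Proof.
case=> u a; rewrite /wreath_mul /= mul1g; congr pair.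
by apply: funext => g; rewrite mul1g.
Qed.

Lemma wreath_mulg1 : right_id wreath_one wreath_mul.
Proof.
case=> u a; rewrite /wreath_mul /= mulg1; congr pair.
by apply: funext => g; rewrite mulg1 mul1g.
Qed.

Lemma wreath_mulVg : left_inverse wreath_one wreath_inv wreath_mul.
Proof.
case=> u a; rewrite /wreath_mul /= mulVg; congr pair.
by apply: funext => g; rewrite mulKg mulVg.
Qed.

Lemma wreath_mulgV : right_inverse wreath_one wreath_inv wreath_mul.
Proof.
case=> u a; rewrite /wreath_mul /= mulgV; congr pair.
by apply: funext => g; rewrite mulgV.
Qed.

HB.instance Definition _ := isGroup.Build wreath wreath_mulA wreath_mul1g
  wreath_mulg1 wreath_mulVg wreath_mulgV.

End Wreath.

(** * Choice of families and construction of homomorphisms *)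

Lemma dep_choice (I : Type) (T_ : I -> Type) (R : forall i, T_ i -> Prop) :
  (forall i, exists x, R i x) -> exists f : forall i, T_ i, forall i, R i (f i).
Proof. by move=> ex; exists (fun i => sval (cid (ex i))) => i; case: cid. Qed.

Lemma ghom_of (G T : groupType) (f : G -> T) :
  {morph f : x y / x * y} -> exists phi : ghom G T, phi =1 f.
Proof.
move=> fM.
have f1 : f 1 = 1 by apply: (mulgI (f 1)); rewrite -fM !mulg1.
pose m := isUMagmaMorphism.Build G T f (conj f1 fM).
pose phi : ghom G T := HB.pack f m.
by exists phi.
Qed.

Lemma ghom_corestrict (L G : groupType) (A : subgroup G) (f : ghom L G) :
  (forall x, carrier A (f x)) ->
  exists g : ghom L (sub_of A), forall x, val (g x) = f x.
Proof.
move=> Af; pose g x : sub_of A := Sub (f x) (mem_set (Af x)).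
have [|phi phiE] := @ghom_of L (sub_of A) g.
  move=> x y; apply: val_inj; rewrite [RHS]gmulfM !SubK; exact: gmulfM.
by exists phi => x; rewrite phiE SubK.
Qed.

(** * Free products: generation, gluing of cocycles, malnormality of the factors *)

Section FreeProduct.
Variables (I : Type) (K_ : I -> groupType) (P : groupType).
Variable j : forall i, ghom (K_ i) P.
Hypothesis freeP : is_free_product j.

(** The maps [j i], corestricted to [A], induce an endomorphism of [P] with values in [A];
    uniqueness in the universal property makes it the identity. *)
Lemma free_product_sub (A : subgroup P) :
  (forall i a, carrier A (j i a)) -> forall g, carrier A g.
Proof.
move=> jA.
have jf i := ghom_corestrict (jA i).
have [f fE] := dep_choice jf.
have [phi [phiE _]] := freeP f.
have [one [_ oneU]] := freeP j.
have [|vphi vphiE] := @ghom_of P P (val \o phi).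
  by move=> x y; rewrite /= !gmulfM.
have [|idP idPE] := @ghom_of P P id; first by [].
move=> g.
have -> : g = vphi g.
  rewrite oneU; last by move=> i k; rewrite vphiE /= phiE fE.
  by rewrite -[LHS]idPE oneU // => i k; rewrite idPE.
by rewrite vphiE; apply: set_mem; apply: valP.
Qed.

Lemma free_product_ind (Q : P -> Prop) :
  Q 1 -> (forall i a g, Q g -> Q (j i a * g)) -> forall g, Q g.
Proof.
move=> Q1 QM.
(* [Q] need not be closed under products, but its stabiliser under left translation is a
   subgroup. *)
pose A := [set g | forall x, Q x <-> Q (g * x)].
have A1 : A 1 by move=> x; rewrite mul1g.
have AM x y : A x -> A y -> A (x * y).
  by move=> Ax Ay z; rewrite -mulgA -Ax -Ay.
have AV x : A x -> A x^-1 by move=> Ax z; rewrite (Ax (x^-1 * z)) mulVKg.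
move=> g; have /(_ 1) : A g.
  apply: (free_product_sub (A := Subgroup A1 AM AV)) => i a x.
  split; first exact: QM.
  by move/(QM i a^-1); rewrite gmulfV mulKg.
by rewrite mulg1 => <-.
Qed.

(* A cocycle on each factor for its translation action on [P] lifts the factor
   to the wreath product of [T] by [P]; extending these lifts to [P] glues the
   cocycles to a coboundary. *)
Lemma free_product_lift (T : groupType) (c : forall i, K_ i -> P -> T) :
  (forall i a b g, c i (a * b) g = c i a (j i b * g) * c i b g) ->
  exists s : P -> T, s 1 = 1 /\ forall i a g, s (j i a * g) = c i a g * s g.
Proof.
move=> cM.
have lf i : exists f : ghom (K_ i) (wreath P T), forall a, f a = (c i a, j i a).
  apply: (@ghom_of _ (wreath P T)) => a b; congr pair; last exact: gmulfM.
  by apply: funext => g; apply: cM.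
have [f fE] := dep_choice lf.
have [phi [phiE _]] := freeP f.
(* As the second component of [phi] is the identity, the first component of [phi (j i a * g)] at [1]
   involves [c i a] at [g] itself. *)
have phi2 g : (phi g).2 = g.
  elim/free_product_ind: g => [|i a g IH]; first by rewrite gmulf1.
  by rewrite gmulfM phiE fE /= IH.
exists (fun g => (phi g).1 1); split=> [|i a g]; first by rewrite gmulf1.
by rewrite gmulfM phiE fE /= phi2 mulg1.
Qed.

(** With [h] ranging over a subgroup, this makes the lift of a cocycle invariant under right
    translation by the subgroup a homomorphism on it. *)
Lemma lift_right (T : groupType) (c : forall i, K_ i -> P -> T) (s : P -> T)
    (h : P) :
  s 1 = 1 -> (forall i a g, s (j i a * g) = c i a g * s g) ->
  (forall i a g, c i a (g * h) = c i a g) ->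
  forall g, s (g * h) = s g * s h.
Proof.
move=> s1 sM cH g; elim/free_product_ind: g => [|i a g IH].
  by rewrite mul1g s1 mul1g.
by rewrite -mulgA !sM cH IH mulgA.
Qed.

(* The cocycle to lift is the identity at the coset [j l K_l] and trivial
   elsewhere. *)
Lemma free_factor_malnormal l m (k : K_ l) (k' : K_ m) (q : P) :
  j m k' * q = q * j l k -> m <> l \/ ~ range (j l) q -> j l k = 1.
Proof.
move=> kq mlq.
pose c i (a : K_ i) g := if `[< i = l /\ range (j l) g >] then j i a else 1.
have range_mul g b : range (j l) (j l b * g) <-> range (j l) g.
  split=> [[x _ xE]|[x _ <-]]; last by exists (b * x); rewrite ?gmulfM.
  by exists (b^-1 * x); rewrite // gmulfM gmulfV xE mulKg.
have [|s [s1 sM]] := free_product_lift (c := c).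
  move=> i a b g; rewrite /c; case: asboolP => [[il rg]|nrg].
    rewrite gmulfM; case: asboolP => // -[]; split=> //.
    by move: a b; rewrite il => a b; apply/range_mul.
  rewrite mulg1; case: asboolP => // -[il rg]; case: nrg; split=> //.
  by move: a b rg; rewrite il => a b /range_mul.
have sk : s (j l k) = j l k.
  rewrite -[j l k]mulg1 sM s1 /c; case: asboolP => // -[]; split=> //.
  by exists 1; rewrite // gmulf1.
(* The cocycle of colour [m] is trivial at [q], so [s] has the same value at
   [j m k' * q = q * j l k] as at [q]; but right multiplication by [j l k] multiplies [s] by
   [s (j l k) = j l k]. *)
have := sM _ k' q; rewrite /c; case: asboolP => [[ml rq]|_]; first by case: mlq.
rewrite mul1g kq (lift_right s1 sM) ?sk; last first.
  move=> i a g; rewrite /c; do 2?case: asboolP => //.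
    move=> nr [il rg]; case: nr; split=> //.
    case: rg => x _ xE; exists (x * k^-1) => //.
    by rewrite gmulfM gmulfV xE mulgK.
  move=> [il [x _ <-]] []; split=> //; exists (x * k) => //.
  by rewrite gmulfM.
by move=> sqk; apply: (mulgI (s q)); rewrite mulg1.
Qed.

End FreeProduct.

(** * The quotient by a normal subgroup *)

Section Quotient.
Local Open Scope quotient_scope.
Variables (G : groupType) (M : subgroup G).
Hypothesis normM : forall g x, carrier M g -> carrier M (g ^ x).

Let eqM (x y : G) : bool := `[< carrier M (x^-1 * y) >].

Let eqM_refl : reflexive eqM.
Proof. by move=> x; apply/asboolP; rewrite mulVg; apply: carrier1. Qed.

Let eqM_sym : symmetric eqM.
Proof.
have imp x y : eqM x y -> eqM y x.
  move=> /asboolP Mxy; apply/asboolP.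
  by rewrite -[x]invgK -invgM; apply: carrierV.
by move=> x y; apply/idP/idP; apply: imp.
Qed.

Let eqM_trans : transitive eqM.
Proof.
move=> y x z /asboolP Mxy /asboolP Myz; apply/asboolP.
by rewrite -[x^-1](mulgK y) -mulgA; apply: carrierM.
Qed.

Let eqMQ := EquivRel eqM eqM_refl eqM_sym eqM_trans.
Let Q := {eq_quot eqMQ}.
Let pi (x : G) : {eq_quot eqMQ} := \pi x.
Let mulQ (u v : Q) : Q := pi (repr u * repr v).
Let invQ (u : Q) : Q := pi (repr u)^-1.

Let piP x y : pi x = pi y <-> carrier M (x^-1 * y).
Proof.
split=> [/eqquotP/asboolP //|Mxy]; apply/eqquotP; exact/asboolP.
Qed.

Let pi_surj (u : Q) : exists x, u = pi x.
Proof. by exists (repr u); rewrite /pi reprK. Qed.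

Let repr_pi x : carrier M (x^-1 * repr (pi x)).
Proof. by apply/piP; rewrite /pi reprK. Qed.

Let mulQE x y : mulQ (pi x) (pi y) = pi (x * y).
Proof.
apply/esym/piP.
have -> : (x * y)^-1 * (repr (pi x) * repr (pi y)) =
    (x^-1 * repr (pi x)) ^ y * (y^-1 * repr (pi y)) by rewrite /conjg ?gnorm.
by apply: carrierM => //; apply: normM.
Qed.

Let invQE x : invQ (pi x) = pi x^-1.
Proof.
apply/piP; have -> : (repr (pi x))^-1^-1 * x^-1 = (x^-1 * repr (pi x)) ^ x^-1.
  by rewrite /conjg ?gnorm.
exact: normM.
Qed.

Lemma quotient_exists :
  exists (R : groupType) (p : ghom G R), forall g, p g = 1 <-> carrier M g.
Proof.
have mA : associative mulQ.
  move=> u v w; have [x ->] := pi_surj u; have [y ->] := pi_surj v.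
  by have [z ->] := pi_surj w; rewrite !mulQE mulgA.
have m1 : left_id (pi 1) mulQ.
  by move=> u; have [x ->] := pi_surj u; rewrite mulQE mul1g.
have m1r : right_id (pi 1) mulQ.
  by move=> u; have [x ->] := pi_surj u; rewrite mulQE mulg1.
have mV : left_inverse (pi 1) invQ mulQ.
  by move=> u; have [x ->] := pi_surj u; rewrite invQE mulQE mulVg.
have mVr : right_inverse (pi 1) invQ mulQ.
  by move=> u; have [x ->] := pi_surj u; rewrite invQE mulQE mulgV.
pose R : groupType := HB.pack {eq_quot eqMQ}
  (isGroup.Build {eq_quot eqMQ} mA m1 m1r mV mVr).
have [|p pE] := @ghom_of G R pi; first by move=> x y; rewrite -mulQE.
exists R, p => g; rewrite pE.
by rewrite -[_ = _]/(pi g = pi 1) (rwP eqP) eq_sym -(rwP eqP) piP invg1 mul1g.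
Qed.

End Quotient.

(** * The kernel of [Theta] is normally generated by its intersections with the factors *)

Section Kernel.
Variables (I : Type) (G_ B_ : I -> groupType) (G B : groupType).
Variables (iG : forall l, ghom (G_ l) G) (iB : forall l, ghom (B_ l) B).
Hypotheses (hG : is_free_product iG) (hB : is_free_product iB).
Variable Theta : ghom G B.
Hypothesis hTheta : forall l, Theta @` image_group (iG l) = image_group (iB l).

Lemma factor_image l a : exists b, Theta (iG l a) = iB l b.
Proof.
have : carrier (image_group (iB l)) (Theta (iG l a)).
  by rewrite -hTheta; exists (iG l a) => //; exists a.
by case=> b _ <-; exists b.
Qed.

Lemma factor_preimage l b : exists a, Theta (iG l a) = iB l b.
Proof.
have : carrier (image_group (iB l)) (iB l b) by exists b.
by rewrite -hTheta => -[_ [a _ <-] <-]; exists a.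
Qed.

(** On each factor [p] factors through [Theta], giving homomorphisms from the [B_ l]. They extend to
    a homomorphism [r] on the free product [B], and [r] after [Theta] is [p]. *)
Lemma factor_kernel_trivial (Q : groupType) (p : ghom G Q) :
  (forall l a, Theta (iG l a) = 1 -> p (iG l a) = 1) ->
  forall g, Theta g = 1 -> p g = 1.
Proof.
move=> pker.
have ker_eq l a a' :
    Theta (iG l a) = Theta (iG l a') -> p (iG l a) = p (iG l a').
  move=> aa'; apply: divg1_eq; rewrite -gmulfF -gmulfF.
  by apply: pker; rewrite !gmulfF aa' mulgV.
have [f fE] := dep_choice (fun l => dep_choice (@factor_preimage l)).
have qf l : exists q : ghom (B_ l) Q, forall b, q b = p (iG l (f l b)).
  apply: ghom_of => b b'; rewrite -!gmulfM.
  by apply: ker_eq; rewrite fE !gmulfM !fE.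
have [q qE] := dep_choice qf.
have [r [rE _]] := hB q.
have rT g : r (Theta g) = p g.
  elim/(free_product_ind hG): g => [|l a g IH]; first by rewrite !gmulf1.
  rewrite !gmulfM IH; congr (_ * _).
  have [b bE] := factor_image a; rewrite bE rE qE; apply: ker_eq.
  by rewrite fE bE.
by move=> g Tg; rewrite -rT Tg gmulf1.
Qed.

(** The set [M] is the normal core of [L]; [factor_kernel_trivial] applies to the quotient of [G] by
    it. *)
Lemma factor_kernel_sub (L : subgroup G) :
  (forall l a x, Theta (iG l a) = 1 -> carrier L (iG l a ^ x)) ->
  forall g, Theta g = 1 -> carrier L g.
Proof.
move=> kerL.
pose M := [set g | forall x, carrier L (g ^ x)].
have M1 : M 1 by move=> x; rewrite conj1g; apply: carrier1.
have MM x y : M x -> M y -> M (x * y).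
  by move=> Mx My z; rewrite conjMg; apply: carrierM.
have MV x : M x -> M x^-1 by move=> Mx z; rewrite conjVg; apply: carrierV.
have [|Q [p pE]] := @quotient_exists G (Subgroup M1 MM MV).
  by move=> g x Mg z; rewrite -conjgM; apply: Mg.
move=> g /(factor_kernel_trivial (p := p)) Mg.
rewrite -[g]conjg1; apply: (pE g).1; apply: Mg => l a la.
by apply/pE => x; apply: kerL.
Qed.

End Kernel.

(** * Homomorphisms on a subgroup, represented by functions on the whole group so that restriction
    leaves them unchanged *)

Definition mulon (G T : groupType) (K : set G) (f : G -> T) :=
  forall x y, K x -> K y -> f (x * y) = f x * f y.

Section Mulon.
Variables (G T : groupType) (K : subgroup G).

Lemma mulon1 (f : G -> T) : mulon K f -> f 1 = 1.
Proof.
move=> fM; apply: (mulgI (f 1)).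
by rewrite -fM ?mulg1 //; apply: carrier1.
Qed.

Lemma mulonV (f : G -> T) x : mulon K f -> carrier K x -> f x^-1 = (f x)^-1.
Proof.
move=> fM Kx; apply: (mulgI (f x)); rewrite -fM ?mulgV ?mulon1 //.
exact: carrierV.
Qed.

Lemma mulon_eq (S : set G) (f g : G -> T) :
  S `<=` K -> (forall A : subgroup G, S `<=` A -> K `<=` A) ->
  mulon K f -> mulon K g -> (forall k, S k -> f k = g k) ->
  forall k, carrier K k -> f k = g k.
Proof.
move=> sSK genK fM gM fg.
pose E := [set k | carrier K k /\ f k = g k].
have E1 : E 1 by split; [exact: carrier1|rewrite (mulon1 fM) (mulon1 gM)].
have EM x y : E x -> E y -> E (x * y).
  by move=> [Kx xE] [Ky yE]; split; [exact: carrierM|rewrite fM // gM // xE yE].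
have EV x : E x -> E x^-1.
  move=> [Kx xE]; split; first exact: carrierV.
  by rewrite (mulonV fM) // (mulonV gM) // xE.
have sKE : K `<=` Subgroup E1 EM EV.
  by apply: genK => x Sx; split; [exact: sSK|exact: fg].
by move=> k /sKE[].
Qed.

Lemma ghom_of_mulon (f : G -> T) :
  mulon K f -> exists phi : ghom (sub_of K) T, forall k, phi k = f (val k).
Proof.
move=> fM; apply: ghom_of => x y; rewrite gmulfM fM //.
  by apply: set_mem; apply: valP.
by apply: set_mem; apply: valP.
Qed.

Lemma ghom_extend (phi : ghom (sub_of K) T) :
  exists f : G -> T, mulon K f /\ forall k, f (val k) = phi k.
Proof.
pose f x := if insub x : option (sub_of K) is Some k then phi k else 1.
have fE k : f (val k) = phi k by rewrite /f valK.
exists f; split=> // x y Kx Ky.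
have := fE (Sub x (mem_set Kx) * Sub y (mem_set Ky)).
by rewrite !gmulfM -!fE !SubK.
Qed.

End Mulon.

(** * A criterion for internal free products *)

Section InternalFreeProduct.
Variables (G : groupType) (K : subgroup G) (I : Type) (K_ : I -> subgroup G).
Hypothesis sKK : forall i, K_ i `<=` K.

Lemma inclusion_exists i :
  exists f : ghom (sub_of (K_ i)) (sub_of K), forall k, val (f k) = val k.
Proof.
have [|v vE] := @ghom_of_mulon G G (K_ i) id; first by [].
have [|f fE] := @ghom_corestrict _ _ K v.
  by move=> x; rewrite vE; apply: sKK; apply: set_mem; apply: valP.
by exists f => k; rewrite fE vE.
Qed.

Hypothesis extK : forall (T : groupType) (f : I -> G -> T),
  (forall i, mulon (K_ i) (f i)) ->
  exists phi : G -> T, mulon K phi /\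
    forall i k, carrier (K_ i) k -> phi k = f i k.
Hypothesis genK : forall A : subgroup G, (forall i, K_ i `<=` A) -> K `<=` A.

Lemma inclusions_eq (T : groupType) (f g : G -> T) :
  mulon K f -> mulon K g -> (forall i k, carrier (K_ i) k -> f k = g k) ->
  forall k, carrier K k -> f k = g k.
Proof.
move=> fM gM fg; pose S := [set k | exists i, carrier (K_ i) k].
apply: (@mulon_eq _ _ K S) => //.
- by move=> x [i]; apply: sKK.
- by move=> A sA; apply: genK => i x Kx; apply: sA; exists i.
- by move=> x [i]; apply: fg.
Qed.

Lemma inclusions_free_product (j : forall i, ghom (sub_of (K_ i)) (sub_of K)) :
  (forall i k, val (j i k) = val k) -> is_free_product j.
Proof.
move=> jE T f.
have [f' f'E] := dep_choice (fun i => ghom_extend (f i)).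
have [phi' [phi'M phi'E]] := extK (fun i => (f'E i).1).
have [phi phiE] := ghom_of_mulon phi'M.
exists phi; split=> [i k|psi psiE k].
  by rewrite phiE jE (phi'E i) ?(f'E i).2 //; apply: set_mem; apply: valP.
have [psi' [psi'M psi'E]] := ghom_extend psi.
rewrite phiE -psi'E; apply: inclusions_eq => //; last first.
  by apply: set_mem; apply: valP.
move=> i x Kx; rewrite (phi'E i) //.
have -> : x = val (Sub x (mem_set Kx) : sub_of (K_ i)) by rewrite SubK.
by rewrite (f'E i).2 -psiE -psi'E jE.
Qed.

(** The free product is realised on [K] itself, with the identity as isomorphism: [extK] gives
    existence and [genK] uniqueness in the universal property. *)
Lemma internal_free_productI : is_internal_free_product K K_.
Proof.
have [j jE] := dep_choice inclusion_exists.
have [|idK idKE] := @ghom_of (sub_of K) (sub_of K) id; first by [].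
exists (sub_of K), j; split; first exact: inclusions_free_product.
exists idK; split=> [i k|]; first by rewrite idKE jE.
by exists id => x; rewrite ?idKE.
Qed.

End InternalFreeProduct.

(** * Coloured groupoids, forests, binding ties and the spanning tree *)

Section Ties.
Variables (I : Type) (G_ B_ : I -> groupType) (G B : groupType).
Variables (iG : forall l, ghom (G_ l) G) (iB : forall l, ghom (B_ l) B).
Hypotheses (hG : is_free_product iG) (hB : is_free_product iB).
Variable Theta : ghom G B.
Hypothesis hTheta : forall l, Theta @` image_group (iG l) = image_group (iB l).
Variable H : subgroup G.
Hypothesis hH : Theta @` H = [set: B].
Implicit Types (D : set (G * G)) (l : I) (x y z : G).

(* [link D l] is the groupoid of colour [l] with [D] added. *)
Inductive link D l x : G -> Prop :=
| link_refl : link D l x x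
| link_factor y a : link D l x y -> link D l x (iG l a * y)
| link_step y z : link D l x y -> D (y, z) -> link D l x z.

(* Cocycles [c l] on the coloured groupoids that agree with the coboundary of
   [s] on each factor glue to that coboundary; [D] is coherent when triviality
   of the [c l] on [D] forces the coboundary to be trivial on [D]. *)
Definition coherent D :=
  forall (T : groupType) (s : G -> T) (c : I -> G -> G -> T),
  (forall l x y z,
     link D l x y -> link D l y z -> c l x z = c l y z * c l x y) ->
  (forall l a x, c l x (iG l a * x) = s (iG l a * x) / s x) ->
  (forall l x y, D (x, y) -> c l x y = 1) ->
  forall x y, D (x, y) -> s x = s y.

(** Invariance under [H] lets [D] be read as a subgroupoid of the action groupoid on the cosets,
    with all objects; [forest_simple] says that its vertex groups are trivial. *)
Record forest D : Prop := Forest {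
  forest_refl : forall x, D (x, x);
  forest_sym : forall x y, D (x, y) -> D (y, x);
  forest_trans : forall x y z, D (x, y) -> D (y, z) -> D (x, z);
  forest_right : forall x y h, carrier H h -> D (x, y) -> D (x * h, y * h);
  forest_simple : forall x h, carrier H h -> D (x, x * h) -> h = 1;
  forest_Theta : forall x y, D (x, y) -> Theta x = Theta y;
  forest_coherent : coherent D }.

Lemma link_trans D l x y z : link D l x y -> link D l y z -> link D l x z.
Proof.
move=> xy; elim=> // [u a _|u v _ xu uv]; first exact: link_factor.
exact: link_step xu uv.
Qed.

Lemma link_mono D D' l x y : D `<=` D' -> link D l x y -> link D' l x y.
Proof.
move=> DD'; elim=> [|u a _ xu|u v _ xu /DD' uv]; first exact: link_refl.
  exact: link_factor.
exact: link_step xu uv.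
Qed.

(** Both sides are cocycles on the groupoid of colour [l] and agree on its generating arrows, the
    factor edges and the edges of [D]. *)
Lemma link_coherent D (T : groupType) (s : G -> T) (c : I -> G -> G -> T) l :
  (forall x y z, link D l x y -> link D l y z -> c l x z = c l y z * c l x y) ->
  (forall a x, c l x (iG l a * x) = s (iG l a * x) / s x) ->
  (forall x y, D (x, y) -> c l x y = 1) ->
  (forall x y, D (x, y) -> s x = s y) ->
  forall x y, link D l x y -> c l x y = s y / s x.
Proof.
move=> cM cs cD sD x y.
have lr z : link D l z z := link_refl D l z.
elim=> [|u a xu IH|u v xu IH uv].
- by apply: (mulgI (c l x x)); rewrite -cM ?mulgV ?mulg1.
- by rewrite (cM _ u) ?cs ?IH ?mulgA ?mulgVK //; apply: link_factor.
- rewrite (cM _ u) ?(cD u v) ?IH ?mul1g ?(sD _ _ uv) //.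
  exact: link_step (lr u) uv.
Qed.

Section Forest.
Variable D : set (G * G).
Hypothesis fD : forest D.

Lemma link_sym l x y : link D l x y -> link D l y x.
Proof.
elim=> [|u a _|u v _ ux uv]; first exact: link_refl.
  apply: link_trans; rewrite -[X in link _ _ _ X](mulKg (iG l a)) -gmulfV.
  exact/link_factor/link_refl.
apply: link_trans ux; apply: (link_step (link_refl D l v)).
exact: forest_sym uv.
Qed.

Lemma link_rel l x y : D (x, y) -> link D l x y.
Proof. exact: link_step (link_refl D l x). Qed.

Lemma link_right l x y h :
  carrier H h -> link D l x y -> link D l (x * h) (y * h).
Proof.
move=> Hh; elim=> [|u a _ IH|u v _ IH uv]; first exact: link_refl.
  by rewrite -mulgA; apply: link_factor.
by apply: link_step IH _; apply: (forest_right fD).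
Qed.

Lemma link_Theta l x y :
  link D l x y -> carrier (image_group (iB l)) (Theta y / Theta x).
Proof.
elim=> [|u a _ IH|u v _ IH uv]; first by rewrite mulgV; apply: carrier1.
  rewrite gmulfM -mulgA; apply: carrierM => //.
  by rewrite -hTheta; exists (iG l a) => //; exists a.
by rewrite -(forest_Theta fD uv).
Qed.

Lemma forest_simple_eq x h h' :
  carrier H h -> carrier H h' -> D (x * h, x * h') -> h = h'.
Proof.
move=> Hh Hh' Dhh'; apply/esym/divg1_eq.
have HV := carrierV Hh; apply: (forest_simple fD (x := x)).
  exact: carrierM.
by rewrite mulgA -{1}(mulgK h x); apply: (forest_right fD).
Qed.

Section Extend.
(* [(u, v)] is a binding tie. *)
Variables (l : I) (u v : G).
Hypotheses (uvl : link D l u v) (uvT : Theta u = Theta v).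
Hypothesis uvD : forall h, carrier H h -> ~ D (u, v * h).

(** The translate of the tie by [h] joins the [D]-components of [u * h] and [v * h]; [near h] is the
    merged component. *)
Let near h x := [/\ carrier H h & D (x, u * h) \/ D (x, v * h)].
Definition tied : set (G * G) :=
  [set p | D p \/ exists2 h, near h p.1 & near h p.2].

Let near_rel h x y : D (x, y) -> near h y -> near h x.
Proof.
move=> xy [Hh nh]; split=> //.
by case: nh => nh; [left|right]; apply: (forest_trans fD) xy nh.
Qed.

(** Merged components for different [h] are disjoint, which keeps [tied] transitive and without
    loops. Two meetings at the same end of the tie contradict simplicity of [D], and meetings at
    opposite ends contradict [uvD]. *)
Let near_uniq h h' x : near h x -> near h' x -> h = h'.
Proof.
have Dsym := forest_sym fD; have Dtr := forest_trans fD.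
have nuv k k' : carrier H k -> carrier H k' -> ~ D (u * k, v * k').
  move=> Hk Hk' Duv; apply: (uvD (h := k' * k^-1)).
    by apply: carrierM => //; apply: carrierV.
  rewrite mulgA -(mulgK k u); apply: (forest_right fD) => //.
  exact: carrierV.
move=> [Hh [xh|xh]] [Hh' [xh'|xh']].
- by apply: (forest_simple_eq (x := u)) => //; apply: Dtr (Dsym _ _ xh) xh'.
- by case: (nuv _ _ Hh Hh'); apply: Dtr (Dsym _ _ xh) xh'.
- by case: (nuv _ _ Hh' Hh); apply: Dtr (Dsym _ _ xh') xh.
- by apply: (forest_simple_eq (x := v)) => //; apply: Dtr (Dsym _ _ xh) xh'.
Qed.

Let near_right h k x : carrier H k -> near h x -> near (h * k) (x * k).
Proof.
move=> Hk [Hh nh]; split; first exact: carrierM.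
by case: nh => nh; [left|right]; rewrite mulgA; apply: (forest_right fD).
Qed.

Let near_Theta h x : near h x -> Theta x = Theta (u * h).
Proof.
by case=> _ [/(forest_Theta fD)//|/(forest_Theta fD)->]; rewrite !gmulfM uvT.
Qed.

Lemma forest_tied : forest tied.
Proof.
split.
- by move=> x; left; apply: (forest_refl fD).
- move=> x y [xy|[h nx ny]]; first by left; apply: (forest_sym fD).
  by right; exists h.
- move=> x y z [xy|[h nx ny]] [yz|[h' ny' nz]].
  + by left; apply: (forest_trans fD) xy yz.
  + by right; exists h' => //; apply: near_rel xy ny'.
  + right; exists h => //; apply: near_rel ny; exact: (forest_sym fD).
  + by right; exists h => //; rewrite (near_uniq ny ny').
- move=> x y k Hk [xy|[h nx ny]]; first by left; apply: (forest_right fD).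
  by right; exists (h * k); apply: near_right.
- move=> x k Hk [xk|[h nx nxk]]; first exact: (forest_simple fD) xk.
  have /(near_uniq nxk)/= E := near_right Hk nx.
  by apply: (mulgI h); rewrite mulg1.
- move=> x y [/(forest_Theta fD)//|[h nx ny]].
  by rewrite (near_Theta nx) (near_Theta ny).
move=> T s c cM cs cD.
have sDD : D `<=` tied by move=> p Dp; left.
have cM' k x y z :
    link D k x y -> link D k y z -> c k x z = c k y z * c k x y.
  by move=> xy yz; apply: cM; apply: link_mono sDD _.
have cD' k x y : D (x, y) -> c k x y = 1 by move/sDD/cD.
have sD := forest_coherent fD cM' cs cD'.
(* The translated tie joins the ends of a path of colour [l], so [c l] on it is the coboundary of
   [s]; as an edge of [tied] it also has trivial [c l]. *)
have suv h : carrier H h -> s (u * h) = s (v * h).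
  move=> Hh; apply/esym/divg1_eq.
  rewrite -(link_coherent (cM' l) (cs l) (cD' l) sD); last first.
    exact: link_right.
  apply: cD; right; exists h; split=> //; [left|right]; exact: (forest_refl fD).
have sn h x : near h x -> s x = s (u * h).
  by case=> Hh [/sD//|/sD->]; rewrite suv.
by move=> x y [/sD//|[h nx ny]]; rewrite (sn _ _ nx) (sn _ _ ny).
Qed.

Lemma tied_uv : tied (u, v).
Proof.
right; exists 1; split; try exact: carrier1; rewrite !mulg1 /=; [left|right];
  exact: (forest_refl fD).
Qed.

End Extend.

(* Otherwise [x ~ y := D-connected mod H, with Theta x = Theta y] would be a
   left-invariant relation identifying [1] with all of [ker Theta]. *)
Lemma forest_connected :
  (forall l u v, link D l u v -> Theta u = Theta v ->
     exists2 h, carrier H h & D (u, v * h)) ->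
  forall x, exists2 h, carrier H h & D (1, x * h).
Proof.
move=> noties.
have Dsym := forest_sym fD; have Dtr := forest_trans fD.
have Dright := forest_right fD.
pose E x y := Theta x = Theta y /\ exists2 h, carrier H h & D (x, y * h).
have Exx x : E x x.
  split=> //; exists 1; first exact: carrier1.
  by rewrite mulg1; apply: (forest_refl fD).
have Esym x y : E x y -> E y x.
  move=> [xy [h Hh Dxy]]; split=> //; exists h^-1; first exact: carrierV.
  by apply: Dsym; rewrite -{1}(mulgK h y); apply: Dright => //; apply: carrierV.
have Etr x y z : E x y -> E y z -> E x z.
  move=> [xy [h Hh Dxy]] [yz [k Hk Dyz]]; split; first by rewrite xy.
  exists (k * h); first exact: carrierM.
  by apply: Dtr Dxy _; rewrite mulgA; apply: Dright.
have Elink l x y : link D l x y -> Theta x = Theta y -> E x y.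
  by move=> lxy Txy; split=> //; apply: noties lxy Txy.
have Eleft g x y : E x y -> E (g * x) (g * y).
  elim/(free_product_ind hG): g => [|l a g IH]; first by rewrite !mul1g.
  move=> /IH[gxy [h Hh Dxy]]; rewrite -!mulgA.
  move: {IH}(g * x) (g * y) gxy Dxy => {}x {}y xy Dxy.
  have Th : Theta (y * h) = Theta y by rewrite -(forest_Theta fD Dxy).
  (* Going back along the letter [a], then along the edge of [D], then forth along [a] is a path of
     colour [l] whose ends have the same image under [Theta]. *)
  have : E (iG l a * x) (iG l a * (y * h)).
    apply: Elink; last by rewrite !gmulfM xy -gmulfM Th.
    apply/link_factor/(link_trans (link_sym _) (link_rel l Dxy)).
    exact/link_factor/link_refl.
  move/Etr; apply; rewrite mulgA; split.
    by rewrite -mulgA !gmulfM -gmulfM Th.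
  by exists h => //; apply: (forest_refl fD).
pose L := [set g | E 1 g].
have LM x y : L x -> L y -> L (x * y).
  by move=> Lx Ly; apply: Etr Lx _; rewrite -{1}[x]mulg1; apply: Eleft.
have LV x : L x -> L x^-1.
  by move=> Lx; apply: Esym; rewrite -(mulVg x) -{1}[x^-1]mulg1; apply: Eleft.
have kerL l a x : Theta (iG l a) = 1 -> L (iG l a ^ x).
  move=> la; rewrite /L /= -(mulVg x) /conjg; apply: Eleft; apply: Elink.
    exact/link_factor/link_refl.
  by rewrite gmulfM la mul1g.
have {}kerL := @factor_kernel_sub _ _ _ _ _ _ _ hG hB _ hTheta
  (Subgroup (Exx 1) LM LV) kerL.
(* Since [H] maps onto [B], right multiplication by an element of [H] brings [x] into the kernel of
   [Theta]. *)
move=> x; have [h Hh hx] : exists2 h, carrier H h & Theta h = (Theta x)^-1.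
  have : [set: B] (Theta x)^-1 by [].
  by rewrite -hH => -[h Hh hx]; exists h.
have [|_ [k Hk D1]] := kerL (x * h); first by rewrite gmulfM hx mulgV.
by exists (h * k); [exact: carrierM|rewrite mulgA].
Qed.

End Forest.

Lemma forest_diag : forest [set p | p.1 = p.2].
Proof.
split=> //= [x y z ->//|x y h _ -> //|x h _|x y ->//|T s c _ _ _ x y /= ->//].
by rewrite -{1}[x]mulg1 => /mulgI.
Qed.

(** Each closure condition involves at most two edges, which lie in one member of the chain; for
    coherence, cocycles on the union restrict to that member. *)
Lemma forest_bigcup (F : set (set (G * G))) :
  F !=set0 -> F `<=` forest -> total_on F subset -> forest (\bigcup_(D in F) D).
Proof.
move=> [D0 FD0] Ff Ftot.
have join D1 D2 p q :
    F D1 -> F D2 -> D1 p -> D2 q -> exists2 D, F D & D p /\ D q.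
  move=> F1 F2 p1 q2.
  case: (Ftot _ _ F1 F2) => D12; [exists D2|exists D1] => //.
    by split=> //; apply: D12.
  by split=> //; apply: D12.
split.
- by move=> x; exists D0 => //; apply: forest_refl; apply: Ff.
- by move=> x y [D FD xy]; exists D => //; apply: forest_sym xy; apply: Ff.
- move=> x y z [D1 F1 xy] [D2 F2 yz].
  have [D FD [{}xy {}yz]] := join _ _ _ _ F1 F2 xy yz.
  by exists D => //; apply: (forest_trans (Ff _ FD)) xy yz.
- move=> x y h Hh [D FD xy]; exists D => //.
  by apply: forest_right xy => //; apply: Ff.
- by move=> x h Hh [D /Ff fD]; apply: (forest_simple fD).
- by move=> x y [D /Ff fD]; apply: (forest_Theta fD).
move=> T s c cM cs cD x y [D FD]; apply: (forest_coherent (Ff _ FD)) (cs) _ _ _.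
  by move=> l p q r pq qr; apply: cM; apply: link_mono (bigcup_sup FD) _.
by move=> l p q pq; apply: cD; exists D.
Qed.

Lemma spanning_tree_exists :
  exists D, forest D /\ forall x, exists2 h, carrier H h & D (1, x * h).
Proof.
have [|D [Dgood Dmax]] :=
  @Zorn_bigcup _ [set D : set (G * G) | D = set0 \/ forest D].
  move=> F FP Ftot.
  pose F' := [set D | F D /\ forest D].
  have FE : \bigcup_(D in F) D = \bigcup_(D in F') D.
    apply/seteqP; split=> p [D FD Dp]; exists D => //; last by case: FD.
    by split=> //; case: (FP _ FD) => // D0; move: Dp; rewrite D0.
  rewrite FE; have [->|/set0P F'0] := eqVneq F' set0.
    by left; apply: bigcup_set0.
  right; apply: forest_bigcup => // [D [] //|D1 D2 [F1 _] [F2 _]]; exact: Ftot.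
have fD : forest D.
  case: Dgood => // D0; case: (Dmax [set p | p.1 = p.2]); last first.
    by right; apply: forest_diag.
  by rewrite D0; split=> [//|/(_ (1, 1))]; apply.
exists D; split=> //; apply: (forest_connected fD) => l u v luv uvT.
apply: contrapT => nuv.
have uvD h : carrier H h -> ~ D (u, v * h).
  by move=> Hh uvh; apply: nuv; exists h.
apply: (Dmax (tied D u v)); last by right; apply: (forest_tied fD luv uvT uvD).
split; first by move=> p Dp; left.
move=> /(_ (u, v) (tied_uv fD u v)) Duv; apply: (uvD 1); first exact: carrier1.
by rewrite mulg1.
Qed.

End Ties.

(** * Kurosh's subgroup theorem, by Schreier transversals *)

Section Kurosh.
Variables (I : Type) (G_ : I -> groupType) (G : groupType).
Variable iG : forall l, ghom (G_ l) G.
Hypothesis hG : is_free_product iG.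
Variable K : subgroup G.
Implicit Types (g k x : G).

Let dc l g : set G := double_coset (image_group (iG l)) g K.

Let dcE l a g k : carrier K k -> dc l (iG l a * g * k) = dc l g.
Proof.
move=> Kk; apply/seteqP; split=> x.
  move=> [_ [b _ <-] [k' Kk' <-]]; exists (iG l b * iG l a).
    by exists (b * a); rewrite ?gmulfM.
  by exists (k * k'); rewrite ?gnorm //; apply: carrierM.
move=> [_ [b _ <-] [k' Kk' <-]]; exists (iG l b / iG l a).
  by exists (b / a); rewrite ?gmulfF.
exists (k^-1 * k'); last by rewrite ?gnorm.
by apply: carrierM => //; apply: carrierV.
Qed.

Let dc_refl l g : dc l g g.
Proof.
exists 1; first by exists 1; rewrite ?gmulf1.
by exists 1; [exact: carrier1|rewrite mul1g mulg1].
Qed.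

Let dc_right l g k : carrier K k -> dc l (g * k) = dc l g.
Proof. by move=> Kk; rewrite -(@dcE l 1 g k Kk) gmulf1 mul1g. Qed.

Let dc_left l a g : dc l (iG l a * g) = dc l g.
Proof. by rewrite -(dcE a g (carrier1 K)) mulg1. Qed.

Let dc_eq l g x : dc l g x -> dc l x = dc l g.
Proof. by move=> [_ [a _ <-] [k Kk <-]]; rewrite dcE. Qed.

Fixpoint within n g : Prop :=
  if n is m.+1 then exists l a, within m (iG l a * g) else carrier K g.

Let within_right n g k : carrier K k -> within n g -> within n (g * k).
Proof.
move=> Kk; elim: n g => [|n IH] g /=; first by move=> Kg; apply: carrierM.
by move=> [l [a ag]]; exists l, a; rewrite mulgA; apply: IH.
Qed.

Let within_ex g : exists n, `[< within n g >].
Proof.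
elim/(free_product_ind hG): g => [|l a g [n /asboolP ng]].
  by exists 0%N; apply/asboolP; apply: carrier1.
by exists n.+1; apply/asboolP; exists l, a^-1; rewrite gmulfV mulKg.
Qed.

(** The distance from [K] to the coset of [g] in the graph on cosets whose edges are left
    multiplications by elements of factors. *)
Definition coset_len g := ex_minn (within_ex g).

Let len_within g : within (coset_len g) g.
Proof. by rewrite /coset_len; case: ex_minnP => n /asboolP. Qed.

Let len_min n g : within n g -> coset_len g <= n.
Proof.
by move=> ng; rewrite /coset_len; case: ex_minnP => m _; apply; apply/asboolP.
Qed.

Let len_right g k : carrier K k -> coset_len (g * k) = coset_len g.
Proof.
move=> Kk; apply/eqP; rewrite eqn_leq len_min; last first.
  exact: within_right (len_within g).
rewrite -{1}(mulgK k g) len_min //.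
by apply: within_right (len_within _); apply: carrierV.
Qed.

Let len0 g : coset_len g = 0%N <-> carrier K g.
Proof.
split=> [g0|Kg]; first by have := len_within g; rewrite g0.
by apply/eqP; rewrite -leqn0; apply: (@len_min 0%N).
Qed.

(* Choosing roots of minimal length in the double cosets makes the edges from a
   root to the cosets one step farther into a spanning tree. *)
Let root l g := xget 1 [set x | dc l g x /\
  forall y, dc l g y -> coset_len x <= coset_len y].

Let rootP l g : dc l g (root l g) /\
  forall y, dc l g y -> coset_len (root l g) <= coset_len y.
Proof.
apply: (@xgetPex _ 1 [set x | dc l g x /\
  forall y, dc l g y -> coset_len x <= coset_len y]).
have ex : exists n, `[< exists2 x, dc l g x & coset_len x = n >].
  by exists (coset_len g); apply/asboolP; exists g.
case: (ex_minnP ex) => n /asboolP[x gx <-] nmin; exists x; split=> // y gy.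
by apply: nmin; apply/asboolP; exists y.
Qed.

Let root_eq l g x : dc l g x -> root l x = root l g.
Proof. by move=> gx; rewrite /root (dc_eq gx). Qed.

(** The letter that leads from the coset of the root to that of [g], normalised to [1] on the coset
    of the root. *)
Let coef l g : G_ l := if `[< carrier K ((root l g)^-1 * g) >] then 1 else
  xget 1 [set a | carrier K ((iG l a * root l g)^-1 * g)].

Let coefP l g : carrier K ((iG l (coef l g) * root l g)^-1 * g).
Proof.
rewrite /coef; case: asboolP => [|_]; first by rewrite gmulf1 mul1g.
apply: (@xgetPex _ 1 [set a | carrier K ((iG l a * root l g)^-1 * g)]).
have [[_ [a _ <-] [k Kk kE]] _] := rootP l g.
exists a^-1; rewrite /= -kE gmulfV ?gnorm.
exact: carrierV.
Qed.

Let carrier_right g k : carrier K k -> carrier K (g * k) = carrier K g.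
Proof.
move=> Kk; apply/propext; split=> [Kgk|Kg]; last exact: carrierM.
by rewrite -(mulgK k g); apply: carrierM => //; apply: carrierV.
Qed.

Let root_right l g k : carrier K k -> root l (g * k) = root l g.
Proof. by move=> Kk; rewrite /root dc_right. Qed.

Let coef_right l g k : carrier K k -> coef l (g * k) = coef l g.
Proof.
move=> Kk; rewrite /coef root_right // mulgA carrier_right //.
case: asboolP => // _; congr xget; apply: funext => a /=.
by rewrite mulgA carrier_right.
Qed.

(** The pair is chosen and not the colour, since [I] may be empty and so offer no default. *)
Let step g := xget (1, 1) [set p : G * G | exists l,
  p = (iG l (coef l g), root l g) /\ coset_len (root l g) < coset_len g].

Let step_right g k : carrier K k -> step (g * k) = step g.
Proof.
move=> Kk; congr xget; apply: funext => p /=; congr ex.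
by apply: funext => l; rewrite coef_right // root_right // len_right.
Qed.

Let stepP g : ~ carrier K g -> exists l,
  step g = (iG l (coef l g), root l g) /\ coset_len (root l g) < coset_len g.
Proof.
move=> nKg; apply: (@xgetPex _ (1, 1) [set p : G * G | exists l,
  p = (iG l (coef l g), root l g) /\ coset_len (root l g) < coset_len g]).
have := len_within g; case lg: (coset_len g) => [|n]; first by move/len0: lg.
move=> /= [l [a ng]]; exists (iG l (coef l g), root l g), l; split=> //.
rewrite ltnS (leq_trans _ (len_min ng)) //; apply: (rootP l g).2.
by rewrite -(dc_left a g); apply: dc_refl.
Qed.

(** The product of the letters met in the spanning tree on the way from the coset of [g] down to
    [K]. The first argument is fuel; [coset_len g] suffices, as each step lowers the length. *)
Fixpoint descend n g : G :=
  if n is m.+1 then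
    if `[< carrier K g >] then 1 else (step g).1 * descend m (step g).2
  else 1.

Let descend_stable n m g :
  coset_len g <= n -> coset_len g <= m -> descend n g = descend m g.
Proof.
elim: n m g => [|n IH] [|m] g //=; rewrite ?leqn0.
- by move=> /eqP/len0 Kg _; case: asboolP.
- by move=> _ /eqP/len0 Kg; case: asboolP.
move=> gn gm; case: asboolP => // /stepP[l [-> lg]] /=; congr (_ * _).
by apply: IH; rewrite -ltnS; apply: leq_trans lg _.
Qed.

Let d g := descend (coset_len g) g.

Let d_K g : carrier K g -> d g = 1.
Proof. by move=> /len0; rewrite /d => ->. Qed.

Let d_step g : ~ carrier K g -> exists l,
  d g = iG l (coef l g) * d (root l g) /\ coset_len (root l g) < coset_len g.
Proof.
move=> nKg; have [l [gl lg]] := stepP nKg; exists l; split=> //.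
rewrite {1}/d; case gn: (coset_len g) lg => [|n] //= lg.
by case: asboolP => // _; rewrite gl /=; congr (_ * _); apply: descend_stable.
Qed.

Let d_right g k : carrier K k -> d (g * k) = d g.
Proof.
move=> Kk; rewrite /d len_right //; case: (coset_len g) => //= n.
by rewrite carrier_right // step_right.
Qed.

Let dP g : carrier K (g^-1 * d g).
Proof.
have [n] := ubnP (coset_len g); elim: n g => // n IH g gn.
have [Kg|nKg] := pselect (carrier K g).
  by rewrite d_K // mulg1; apply: carrierV.
have [l [-> lg]] := d_step nKg.
have -> : g^-1 * (iG l (coef l g) * d (root l g)) =
    ((iG l (coef l g) * root l g)^-1 * g)^-1 * ((root l g)^-1 * d (root l g)).
  by rewrite ?gnorm.
apply: carrierM; first by apply: carrierV; apply: coefP.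
by apply: IH; apply: leq_trans lg _.
Qed.

Definition kurosh_rep l g := d (root l g).
Notation rep := kurosh_rep.

(** Each colour has its own transversal besides the tree transversal [d]: a coset is reached by one
    letter from the representative of its double coset. *)
Let arm l g := iG l (coef l g) * rep l g.

(** The discrepancy between the two transversals. It is [1] on the tree edges, and the others
    generate the free part. *)
Definition kurosh_gen l g := (d g)^-1 * arm l g.
Notation gen := kurosh_gen.

Let rep_root l g : carrier K ((root l g)^-1 * rep l g).
Proof. exact: dP. Qed.

Let armP l g : carrier K (g^-1 * arm l g).
Proof.
have -> : g^-1 * arm l g =
    ((iG l (coef l g) * root l g)^-1 * g)^-1 * ((root l g)^-1 * rep l g).
  by rewrite /arm ?gnorm.
by apply: carrierM; [apply: carrierV; apply: coefP|apply: rep_root].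
Qed.

Let root_rep l g : root l (rep l g) = root l g.
Proof.
rewrite -[rep l g](mulVKg (root l g)) root_right; last exact: rep_root.
by apply: root_eq; apply: (rootP l g).1.
Qed.

Let coef_rep l g : coef l (rep l g) = 1.
Proof.
by rewrite /coef root_rep; case: asboolP => //; case; apply: rep_root.
Qed.

Let d_rep l g : d (rep l g) = rep l g.
Proof.
by rewrite -{1}[rep l g](mulVKg (root l g)) d_right //; apply: rep_root.
Qed.

Let len_rep l g : coset_len (rep l g) = coset_len (root l g).
Proof.
by rewrite -[rep l g](mulVKg (root l g)) len_right //; apply: rep_root.
Qed.

Lemma kurosh_rep_right l g k : carrier K k -> rep l (g * k) = rep l g.
Proof. by move=> Kk; rewrite /rep root_right. Qed.

Lemma kurosh_rep_left l a g : rep l (iG l a * g) = rep l g.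
Proof.
rewrite /rep; congr d; apply: root_eq; rewrite -(dc_left a g).
exact: dc_refl.
Qed.

Lemma kurosh_rep_id l g : rep l (rep l g) = rep l g.
Proof. by rewrite {1}/rep root_rep. Qed.

Lemma kurosh_rep1 l : rep l 1 = 1.
Proof.
apply: d_K; apply/len0/eqP; rewrite -leqn0.
apply: leq_trans ((rootP l 1).2 1 (dc_refl l 1)) _.
by apply: (@len_min 0%N); apply: carrier1.
Qed.

Lemma kurosh_rep_dc l g :
  exists a k, carrier K k /\ rep l g = iG l a * g * k.
Proof.
exists (coef l g)^-1, (g^-1 * arm l g); split; first exact: armP.
by rewrite /arm gmulfV ?gnorm.
Qed.

Let gen_right l g k : carrier K k -> gen l (g * k) = gen l g.
Proof.
by move=> Kk; rewrite /gen /arm d_right // coef_right // kurosh_rep_right.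
Qed.

Let gen_rep l g : gen l (rep l g) = 1.
Proof.
by rewrite /gen /arm d_rep coef_rep kurosh_rep_id gmulf1 mul1g mulVg.
Qed.

Lemma kurosh_gen_sub l g : carrier K (gen l g).
Proof.
have -> : gen l g = (g^-1 * d g)^-1 * (g^-1 * arm l g) by rewrite /gen ?gnorm.
by apply: carrierM; [apply: carrierV; apply: dP|apply: armP].
Qed.

Notation meetK l x := (meet_group K (conj_group (image_group (iG l)) x)).

(** The Schreier generator of the letter [a] for the transversal of colour [l]; no other colour
    enters it, so it lies in a conjugate of the factor. *)
Let turn l (a : G_ l) g := (arm l (iG l a * g))^-1 * (iG l a * arm l g).

Let turnP l a g : carrier (meetK l (rep l g)) (@turn l a g).
Proof.
split.
  have -> : turn a g =
      ((iG l a * g)^-1 * arm l (iG l a * g))^-1 * (g^-1 * arm l g).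
    by rewrite /turn ?gnorm.
  by apply: carrierM; [apply: carrierV; apply: armP|apply: armP].
exists ((iG l (coef l (iG l a * g)))^-1 * iG l a * iG l (coef l g)).
  by exists ((coef l (iG l a * g))^-1 * a * coef l g); rewrite ?gmulfM ?gmulfV.
by rewrite /turn /arm kurosh_rep_left /conjg ?gnorm.
Qed.

Let turnM l a b g : @turn l (a * b) g = turn a (iG l b * g) * turn b g.
Proof. by rewrite /turn gmulfM ?gnorm. Qed.

(** For a letter [a] of colour [l], the Schreier generator [(d (a * g))^-1 * a * d g] equals
    [gen l (a * g) * turn a g * (gen l g)^-1]. Applying [t] and [f] to these pieces gives a cocycle
    invariant under [K], and its lift is the required homomorphism. *)
Lemma kurosh_extend (T : groupType) (f : I -> G -> G -> T) (t : G -> T) :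
  t 1 = 1 ->
  (forall l g, mulon (meetK l (rep l g)) (f l (rep l g))) ->
  exists phi : G -> T, [/\ mulon K phi,
    forall l g k, carrier (meetK l (rep l g)) k -> phi k = f l (rep l g) k &
    forall l g, phi (gen l g) = t (gen l g)].
Proof.
move=> t1 fM.
pose c l a g := t (gen l (iG l a * g)) * f l (rep l g) (turn a g) / t (gen l g).
have [|s [s1 sM]] := free_product_lift hG (c := c).
  move=> l a b g; rewrite /c turnM kurosh_rep_left gmulfM fM ?gnorm //.
  by rewrite -{1}(kurosh_rep_left b g); apply: turnP.
have cK l a g k : carrier K k -> c l a (g * k) = c l a g.
  move=> Kk; rewrite /c /turn /arm (mulgA (iG l a) g k) !(gen_right _ _ Kk).
  by rewrite !(kurosh_rep_right _ _ Kk) !(coef_right _ _ Kk).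
have sK g k : carrier K k -> s (g * k) = s g * s k.
  by move=> Kk; apply: (lift_right hG s1 sM) => l a x; apply: cK.
have c_rep l a g : c l a (rep l g) =
    t (gen l (iG l a * rep l g)) *
    f l (rep l g) ((arm l (iG l a * rep l g))^-1 * (iG l a * rep l g)).
  rewrite /c gen_rep t1 invg1 mulg1 kurosh_rep_id; congr (_ * f _ _ _).
  by rewrite /turn {2}/arm coef_rep kurosh_rep_id gmulf1 mul1g.
have f1 l g : f l (rep l g) 1 = 1 by apply: mulon1 (fM l g).
have arm_rep l g : arm l (arm l g) = arm l g.
  rewrite -{1}[arm l g](mulVKg g) /arm coef_right ?kurosh_rep_right //;
    exact: armP.
have gen_arm l g : gen l (arm l g) = gen l g.
  by rewrite -{1}[arm l g](mulVKg g) gen_right //; apply: armP.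
have sarm l g : s (rep l g) = 1 -> s (arm l g) = t (gen l g).
  move=> srep; rewrite {1}/arm sM srep mulg1 c_rep -/(arm l g) gen_arm arm_rep.
  by rewrite mulVg f1 mulg1.
(* By induction on the length, [s] is trivial on the tree transversal: along a tree edge [gen] is
   [1] and [t 1 = 1]. *)
have sd g : s (d g) = 1.
  have [n] := ubnP (coset_len g); elim: n g => // n IH g gn.
  have [Kg|nKg] := pselect (carrier K g); first by rewrite d_K.
  have [l [dE lg]] := d_step nKg.
  rewrite dE -/(arm l g) sarm; last first.
    by rewrite -d_rep; apply: IH; rewrite len_rep; apply: leq_trans lg _.
  by rewrite /gen /arm dE mulVg.
have srep l g : s (rep l g) = 1 by rewrite -d_rep sd.
exists s; split=> [x y _ Ky|l g k [Kk [_ [a _ <-] kE]]|l g]; first exact: sK.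
  have aE : iG l a * rep l g = rep l g * k by rewrite -kE /conjg mulVKg.
  have <- : s (rep l g * k) = s k by rewrite sK // srep mul1g.
  rewrite -aE sM srep mulg1 c_rep aE gen_right // gen_rep t1 mul1g.
  congr f; rewrite /arm coef_right // kurosh_rep_right // coef_rep.
  by rewrite kurosh_rep_id gmulf1 mul1g mulKg.
have : s (d g * gen l g) = t (gen l g) by rewrite /gen mulVKg sarm.
by rewrite sK ?sd ?mul1g //; apply: kurosh_gen_sub.
Qed.

(** The same factorisation of Schreier generators puts [(d g)^-1 * g] in [A] by induction on [g],
    and [d] is [1] on [K]. *)
Lemma kurosh_generate (A : subgroup G) :
  (forall l g, meetK l (rep l g) `<=` A) -> (forall l g, carrier A (gen l g)) ->
  K `<=` A.
Proof.
move=> meetA genA.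
have dA g : carrier A ((d g)^-1 * g).
  elim/(free_product_ind hG): g => [|l a g IH].
    by rewrite d_K ?mulg1 ?invg1; apply: carrier1.
  have -> : (d (iG l a * g))^-1 * (iG l a * g) =
      gen l (iG l a * g) * turn a g * (gen l g)^-1 * ((d g)^-1 * g).
    by rewrite /gen /turn ?gnorm.
  apply: carrierM => //; apply: carrierM; last exact: carrierV.
  by apply: carrierM => //; apply: meetA (turnP a g).
by move=> k Kk; have := dA k; rewrite d_K // invg1 mul1g.
Qed.

End Kurosh.

(** * Generated subgroups and a criterion for freeness *)

Section Generated.
Variables (G : groupType) (S : set G).

Program Definition generated : subgroup G :=
  @Subgroup G [set x | forall A : subgroup G, S `<=` A -> carrier A x] _ _ _.
Next Obligation. by move=> A _; apply: carrier1. Qed.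
Next Obligation.
by move=> x y Sx Sy A sA; apply: carrierM; [exact: Sx|exact: Sy].
Qed.
Next Obligation. by move=> x Sx A sA; apply/carrierV/Sx. Qed.

Lemma sub_generated : S `<=` generated.
Proof. by move=> x Sx A sA; apply: sA. Qed.

Lemma generated_sub (A : subgroup G) : S `<=` A -> generated `<=` A.
Proof. by move=> sA x gx; apply: gx. Qed.

Lemma generated_eq (T : groupType) (f g : G -> T) :
  mulon generated f -> mulon generated g -> (forall x, S x -> f x = g x) ->
  forall x, carrier generated x -> f x = g x.
Proof. by apply: mulon_eq; [exact: sub_generated|exact: generated_sub]. Qed.

End Generated.

Lemma mulonS (G T : groupType) (A B : set G) (f : G -> T) :
  A `<=` B -> mulon B f -> mulon A f.
Proof. by move=> AB fM x y /AB Bx /AB By; apply: fM. Qed.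

(** As [Y] may contain [1], the basis consists of its nontrivial elements; assignments on it
    correspond to assignments on [Y] that respect [t 1 = 1]. *)
Lemma generated_free (G : groupType) (Y : set G) :
  (forall (T : groupType) (t : G -> T), t 1 = 1 ->
    exists phi : G -> T,
      mulon (generated Y) phi /\ forall y, Y y -> phi y = t y) ->
  is_free_group (sub_of (generated Y)).
Proof.
move=> extY; pose S := [set s : sub_of (generated Y) | Y (val s) /\ val s <> 1].
exists S => T f.
pose t y := if pselect (exists s : S, val (val s) = y) is left ex
  then f (sval (cid ex)) else 1.
have S_neq1 (s : S) : val (val s) <> 1 by have /set_mem[] := valP s.
have tE s : t (val (val s)) = f s.
  rewrite /t; case: pselect => [ex|[]]; last by exists s.
  by case: cid => s' /= E; congr f; do 2!apply: val_inj.
have t1 : t 1 = 1.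
  by rewrite /t; case: pselect => // ex; have [s /S_neq1] := ex.
have [phi' [phi'M phi'E]] := extY T t t1.
have [phi phiE] := ghom_of_mulon phi'M.
have YS (s : S) : Y (val (val s)) by have /set_mem[] := valP s.
exists phi; split=> [s|psi psiE k]; first by rewrite phiE phi'E.
have [psi' [psi'M psi'E]] := ghom_extend psi.
rewrite phiE -psi'E; apply: (generated_eq psi'M phi'M) => [y Yy|]; last first.
  by apply: set_mem; apply: valP.
have [->|y1] := pselect (y = 1); first by rewrite (mulon1 psi'M) (mulon1 phi'M).
have gy := sub_generated Yy.
have Ss : S (Sub y (mem_set gy)) by split; rewrite SubK.
pose s : S := SigSub (mem_set Ss).
have -> : y = val (val s) by rewrite /s SubK.
by rewrite psi'E psiE phi'E ?tE.
Qed.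

(** * The vertex groups of a spanning tree and their free product *)

Section Main.
Variables (I : Type) (G_ B_ : I -> groupType) (G B : groupType).
Variables (iG : forall l, ghom (G_ l) G) (iB : forall l, ghom (B_ l) B).
Hypothesis hG : is_free_product iG.
Variable Theta : ghom G B.
Hypothesis hTheta : forall l, Theta @` image_group (iG l) = image_group (iB l).
Variables (H : subgroup G) (D : set (G * G)).
Hypothesis fD : forest iG Theta H D.
Hypothesis connD : forall x, exists2 h, carrier H h & D (1, x * h).
Implicit Types (g h k x y z : G) (l : I).

Let Drefl := forest_refl fD.
Let Dsym := forest_sym fD.
Let Dtrans := forest_trans fD.
Let Dright := forest_right fD.
Local Notation link := (link iG D).
Let link_sym := link_sym fD.
Let link_rel l x y : D (x, y) -> link l x y.
Proof. exact: link_rel. Qed.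
Let link_right := link_right fD.

Let e x := xget 1 [set y | carrier H (x^-1 * y) /\ D (1, y)].

Let eP x : carrier H (x^-1 * e x) /\ D (1, e x).
Proof.
apply: (@xgetPex _ 1 [set y | carrier H (x^-1 * y) /\ D (1, y)]).
by have [h Hh xh] := connD x; exists (x * h); rewrite /= mulKg.
Qed.

Let e_uniq x y : carrier H (x^-1 * y) -> D (1, y) -> e x = y.
Proof.
move=> Hy D1y; have [Hx D1x] := eP x.
have /(forest_simple_eq fD Hx Hy) : D (x * (x^-1 * e x), x * (x^-1 * y)).
  by rewrite !mulVKg; apply: Dtrans (Dsym D1x) D1y.
exact: mulgI.
Qed.

Let e_right x h : carrier H h -> e (x * h) = e x.
Proof.
move=> Hh; have [Hx D1x] := eP x; apply: e_uniq => //.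
by rewrite invgM -mulgA; apply: carrierM => //; apply: carrierV.
Qed.

Let e1 : e 1 = 1.
Proof. by apply: e_uniq => //; rewrite mulg1; apply/carrierV/carrier1. Qed.

(* [shift x] is the element of [H] that carries [e x], the representative of
   [x H] in the spanning tree, to [x]. *)
Let shift x := (e x)^-1 * x.

Let shiftH x : carrier H (shift x).
Proof.
by have [Hx _] := eP x; have := carrierV Hx; rewrite invgM invgK.
Qed.

Let shift_right x h : carrier H h -> shift (x * h) = shift x * h.
Proof. by move=> Hh; rewrite /shift e_right // mulgA. Qed.

Let shift1 : shift 1 = 1. Proof. by rewrite /shift e1 mulVg. Qed.

Let shift_id h : carrier H h -> shift h = h.
Proof. by move=> Hh; rewrite -[h]mul1g shift_right // shift1. Qed.

Let shiftD x : D (shift x, x).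
Proof.
have [_ D1x] := eP x.
by have := Dright (shiftH x) D1x; rewrite mul1g /shift mulVKg.
Qed.

Let shift_link l x y : link l x y -> link l (shift x) (shift y).
Proof.
move=> xy; apply: link_trans (link_rel l (shiftD x)) _.
exact: link_trans xy (link_rel l (Dsym (shiftD y))).
Qed.

Let shift_eq x y : D (x, y) -> shift x = shift y.
Proof.
move=> xy; apply: (forest_simple_eq fD (x := 1)) => //; rewrite !mul1g.
by apply: Dtrans (shiftD x) _; apply: Dtrans xy _; apply: Dsym.
Qed.

Program Definition vertex_group l : subgroup G :=
  @Subgroup G [set h | carrier H h /\ link l 1 h] _ _ _.
Next Obligation. by move=> l; split; [exact: carrier1|exact: link_refl]. Qed.
Next Obligation.
move=> l x y [Hx lx] [Hy ly]; split; first exact: carrierM.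
by apply: link_trans ly _; rewrite -{1}[y]mul1g; apply: link_right.
Qed.
Next Obligation.
move=> l x [Hx lx]; have HV := carrierV Hx; split=> //.
by have := link_right HV lx; rewrite mul1g mulgV => /link_sym.
Qed.
Local Notation V := vertex_group.

Let shift_vertex l x y : link l x y -> carrier (V l) (shift y / shift x).
Proof.
move=> /shift_link xy; have HV := carrierV (shiftH x).
split; first exact: carrierM.
by have := link_right HV xy; rewrite mulgV.
Qed.

Let shift_link1 l x : link l 1 x <-> link l 1 (shift x).
Proof.
split=> lx; apply: link_trans lx _; apply: link_rel => //; exact: Dsym.
Qed.

(** Along a path of colour [l], [shift] changes by an element of [V l], so [f l] yields a cocycle,
    trivial on [D]. Coherence makes the lift [s] of these cocycles constant along [D], and then
    [link_coherent] identifies [s] with [f l] on [V l]. *)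
Lemma vertex_group_extend (T : groupType) (f : I -> G -> T) :
  (forall l, mulon (V l) (f l)) ->
  exists phi : G -> T, mulon H phi /\
    forall l k, carrier (V l) k -> phi k = f l k.
Proof.
move=> fM; pose c l x y := f l (shift y / shift x).
have cM l x y z : link l x y -> link l y z -> c l x z = c l y z * c l x y.
  move=> xy yz; by rewrite /c -fM ?divgKA //; apply: shift_vertex.
have [|s [s1 sM]] :=
  free_product_lift hG (c := fun l a g => c l g (iG l a * g)).
  move=> l a b g; rewrite gmulfM -mulgA; apply: cM.
    exact/link_factor/link_refl.
  exact/link_factor/link_refl.
have cH l a h g :
    carrier H h -> c l (g * h) (iG l a * (g * h)) = c l g (iG l a * g).
  by move=> Hh; rewrite /c (mulgA (iG l a) g h) !(shift_right _ Hh) mulgKA.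
have cD l x y : D (x, y) -> c l x y = 1.
  by move=> xy; rewrite /c (shift_eq xy) mulgV (mulon1 (fM l)).
have cs l a x : c l x (iG l a * x) = s (iG l a * x) / s x by rewrite sM mulgK.
have sD := forest_coherent fD cM cs cD.
exists s; split=> [x y _ Hy|l k [Hk lk]].
  by apply: (lift_right hG s1 sM) => l a g; apply: cH.
have := link_coherent (cM l) (cs l) (cD l) sD lk.
by rewrite s1 divg1 => <-; rewrite /c shift1 divg1 shift_id.
Qed.

Lemma vertex_group_generate (A : subgroup G) :
  (forall l, V l `<=` A) -> H `<=` A.
Proof.
move=> VA h Hh; rewrite -(shift_id Hh).
elim/(free_product_ind hG): {Hh} h => [|l a g IH].
  by rewrite shift1; apply: carrier1.
rewrite -(mulgVK (shift g) (shift _)); apply: carrierM => //.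
by apply: (VA l); apply/shift_vertex/link_factor/link_refl.
Qed.

Lemma vertex_groupS l : V l `<=` H. Proof. by move=> x []. Qed.

Lemma vertex_group_free_product : is_internal_free_product H V.
Proof.
apply: internal_free_productI; first exact: vertex_groupS.
  exact: vertex_group_extend.
exact: vertex_group_generate.
Qed.

Lemma vertex_group_image l : Theta @` V l = image_group (iB l).
Proof.
apply/seteqP; split=> b; first move=> [h [_ lh] <-].
  by have := link_Theta hTheta fD lh; rewrite gmulf1 divg1.
(* An edge of [D] joins an element to its shift, so both have the same image under [Theta] and are
   linked to [1] in the same colours. *)
rewrite -{1}hTheta => -[_ [a _ <-] <-]; exists (shift (iG l a)).
  split=> //; apply: (shift_link1 _ _).1; rewrite -[iG l a]mulg1.
  exact/link_factor/link_refl.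
by rewrite (forest_Theta fD (shiftD _)).
Qed.

Local Notation meet K l x := (meet_group K (conj_group (image_group (iG l)) x)).

(** For [k] the conjugate of [a] by [x], the path runs from [1] to [x], on to [a * x = x * k], and
    back to [k] along the first piece translated by [k]. *)
Lemma meet_vertex_group l x : link l 1 x -> meet H l x `<=` V l.
Proof.
move=> lx k [Hk [_ [a _ <-] kE]]; split=> //.
apply: (link_trans lx (link_sym _)).
have := link_right Hk lx; rewrite mul1g -{2}kE /conjg mulVKg => kx.
apply: link_trans kx (link_sym _); exact/link_factor/link_refl.
Qed.

(* For [k = a ^ x] with [a] in the factor [m], the conjugate of [k] by
   [shift x] lies in [vertex_group m], so malnormality applies. *)
Lemma meet_other_trivial l m x k :
  m <> l \/ ~ link l 1 x -> carrier (meet (V l) m x) k -> k = 1.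
Proof.
move=> mlx [Vk [_ [a _ <-] kE]].
have [j jE] := dep_choice (inclusion_exists vertex_groupS).
have jfree := inclusions_free_product vertex_groupS vertex_group_extend
  vertex_group_generate jE.
have qE : shift (iG m a * x) = shift x * k.
  by rewrite -shift_right; [rewrite -kE /conjg mulVKg|case: Vk].
have Vk' : carrier (V m) (shift x * k / shift x).
  by rewrite -qE; apply/shift_vertex/link_factor/link_refl.
pose k1 : sub_of (V l) := SigSub (mem_set Vk).
pose k2 : sub_of (V m) := SigSub (mem_set Vk').
pose q : sub_of H := SigSub (mem_set (shiftH x)).
have k1E : val (j l k1) = k by rewrite jE SubK.
rewrite -k1E (free_factor_malnormal jfree (k' := k2) (q := q)) ?gmulf1 //.
  by apply: val_inj; rewrite [LHS]gmulfM [RHS]gmulfM /= !jE /= mulgVK.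
case: mlx => [|nlx]; [by left|right=> -[h _ hq]; apply: nlx].
apply: (shift_link1 _ _).2; have := set_mem (valP h) => -[_].
by rewrite -jE hq SubK.
Qed.

(** * The Kurosh decomposition of one vertex group *)

Section Vertex.
Variable l : I.
Local Notation rep := (kurosh_rep hG (V l)).

(** A letter of colour [l] on the left leaves the double coset unchanged and can make the image
    under [Theta] trivial; the last condition keeps [1] as a representative. *)
Let adjusted x : set G :=
  [set z | [/\ exists a, z = iG l a * x, Theta z = 1 & x = 1 -> z = 1]].

Let adjust x := xget x (adjusted x).

Let adjustP x : link l 1 x -> adjusted x (adjust x).
Proof.
move=> lx; apply: (@xgetPex _ x).
have [->|x1] := pselect (x = 1).
  by exists 1; split; rewrite ?gmulf1 //; exists 1; rewrite gmulf1 mulg1.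
have := link_Theta hTheta fD lx.
rewrite gmulf1 divg1 -hTheta => -[_ [a _ <-] ax].
exists (iG l a^-1 * x); split=> //; first by exists a^-1.
by rewrite gmulfM !gmulfV ax mulVg.
Qed.

Definition coset_reps : set G :=
  [set z | exists g, link l 1 (rep l g) /\ z = adjust (rep l g)].
Local Notation X := coset_reps.

Lemma coset_repsP z : X z -> link l 1 z /\ Theta z = 1.
Proof.
move=> [g [lg ->]]; have [[a aE] T1 _] := adjustP lg; split=> //.
by rewrite aE; apply: link_factor.
Qed.

Lemma coset_reps1 : X 1.
Proof.
have rep1 : rep l 1 = 1 by apply: kurosh_rep1.
have l1 : link l 1 (rep l 1) by rewrite rep1; apply: link_refl.
by exists 1; split=> //; have [_ _ /(_ rep1)->] := adjustP l1.
Qed.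

(** Existence holds because [e x] is a point of the coset of [x] linked to [1]. For uniqueness, if
    two points linked to [1] lie in the same double coset of [H], the element [h'] of [H] relating
    them is itself linked to [1]. So it lies in [V l], and the double cosets of [V l] agree. *)
Lemma coset_reps_uniq x :
  exists! y, X y /\ double_coset (image_group (iG l)) x H y.
Proof.
have [Hx D1x] := eP x.
have [a [k [[Hk lk] repE]]] := kurosh_rep_dc hG (V l) l (e x).
have lrep : link l 1 (rep l (e x)).
  rewrite repE; apply: link_trans lk _; rewrite -{1}[k]mul1g.
  apply: link_right => //.
  exact/link_factor/link_rel.
have Xy : X (adjust (rep l (e x))) by exists (e x).
exists (adjust (rep l (e x))); split; first split=> //.
  have [[b ->] _ _] := adjustP lrep.
  exists (iG l (b * a)); first by exists (b * a).
  exists (x^-1 * e x * k); first exact: carrierM.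
  by rewrite repE gmulfM ?gnorm.
move=> z [[g [lg zE]] zx].
suff -> : rep l (e x) = rep l g by rewrite zE.
have [[b bE] _ _] := adjustP lg; rewrite -zE in bE.
case: zx => [_ [c _ <-] [h Hh zE']].
pose h' := k^-1 * (x^-1 * e x)^-1 * h.
have Hh' : carrier H h'.
  by apply: carrierM => //; apply: carrierM; apply: carrierV.
have gE : rep l g = iG l (b^-1 * c * a^-1) * rep l (e x) * h'.
  rewrite -[LHS](mulKg (iG l b)) -bE -zE' repE /h' !gmulfM !gmulfV ?gnorm //.
have Vh' : carrier (V l) h'.
  split=> //; apply: link_trans lg (link_sym _); rewrite gE -mulgA.
  apply: link_factor; have := link_right Hh' lrep; by rewrite mul1g.
rewrite -[RHS]kurosh_rep_id gE kurosh_rep_right // kurosh_rep_left.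
by rewrite kurosh_rep_id.
Qed.

Let Y : set G := [set y | exists m g, y = kurosh_gen hG (V l) m g].

Let meet_adjust x : link l 1 x -> meet H l (adjust x) `<=>` meet (V l) l x.
Proof.
move=> lx; have [[a aE] _ _] := adjustP lx.
split=> k.
  move=> Mk; split.
    by apply: meet_vertex_group Mk; rewrite aE; apply: link_factor.
  case: Mk => _ [_ [b _ <-] <-]; exists (iG l (b ^ a)); first by exists (b ^ a).
  by rewrite aE gmulfJ conjgM.
move=> [/vertex_groupS Hk [_ [b _ <-] kE]]; split=> //; rewrite -{}kE.
exists (iG l (b ^ a^-1)); first by exists (b ^ a^-1).
by rewrite aE gmulfJ conjgM gmulfV conjgKV.
Qed.

Lemma vertex_group_kurosh_extend (T : groupType) (f : G -> G -> T)
    (t : G -> T) :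
  t 1 = 1 -> (forall z, X z -> mulon (meet H l z) (f z)) ->
  exists phi : G -> T, [/\ mulon (V l) phi,
    forall z k, X z -> carrier (meet H l z) k -> phi k = f z k &
    forall y, Y y -> phi y = t y].
Proof.
move=> t1 fM.
(* Kurosh's theorem asks for maps on all conjugates; off those of [G_ l] by points linked to [1] the
   trivial map is prescribed. *)
pose f' m x := if `[< m = l /\ link l 1 x >] then f (adjust x) else fun=> 1.
have [|phi [phiM phiE phiY]] :=
  kurosh_extend (hG := hG) (K := V l) (f := f') t1.
  move=> m g; rewrite /f'.
  case: asboolP => [[-> lg]|_ u v _ _]; last by rewrite mulg1.
  by apply: (mulonS (meet_adjust lg).2); apply: fM; exists g.
exists phi; split=> [//|z k [g [lg ->]] Mk|y [m [g ->]]]; last exact: phiY.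
rewrite (phiE l g); last exact: (meet_adjust lg).1.
by rewrite /f'; case: asboolP => // -[].
Qed.

Lemma vertex_group_kurosh_generate (A : subgroup G) :
  (forall z, X z -> meet H l z `<=` A) -> Y `<=` A -> V l `<=` A.
Proof.
move=> XA YA; apply: (kurosh_generate (hG := hG)) => [m g k Mk|m g]; last first.
  by apply: YA; exists m, g.
(* In the second case malnormality leaves only the trivial intersection. *)
have [[ml lg]|nmlg] := pselect (m = l /\ link l 1 (rep m g)).
  rewrite ml in lg Mk; apply: (XA (adjust (rep l g))); first by exists g.
  exact: (meet_adjust lg).2.
rewrite (meet_other_trivial _ Mk); first exact: carrier1.
have [ml|] := pselect (m = l); last by left.
by right=> lg; apply: nmlg; split=> //.
Qed.

Definition vertex_meets : subgroup G :=
  generated [set k | exists2 z, X z & carrier (meet H l z) k].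
Definition vertex_free : subgroup G := generated Y.

Lemma vertex_meetsS : vertex_meets `<=` V l.
Proof.
apply: generated_sub => k [z /coset_repsP[lz _]]; exact: meet_vertex_group.
Qed.

Lemma vertex_freeS : vertex_free `<=` V l.
Proof. by apply: generated_sub => y [m [g ->]]; apply: kurosh_gen_sub. Qed.

Lemma vertex_free_group : is_free_group (sub_of vertex_free).
Proof.
apply: generated_free => T t t1.
have [|phi [phiM _ phiY]] := @vertex_group_kurosh_extend T (fun _ _ => 1) t t1.
  by move=> z _ u v _ _; rewrite mulg1.
by exists phi; split=> //; apply: mulonS vertex_freeS phiM.
Qed.

Lemma vertex_meets_free_product :
  is_internal_free_product vertex_meets (fun x : X => meet H l (val x)).
Proof.
have Xval (x : X) : X (val x) by apply: set_mem; apply: valP.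
apply: internal_free_productI => [x k Mk|T f fM|A MA].
- by apply: sub_generated; exists (val x).
- pose f' z :=
    if pselect (X z) is left Xz then f (SigSub (mem_set Xz)) else fun=> 1.
  have f'E (x : X) : f' (val x) = f x.
    by rewrite /f'; case: pselect => // Xz; congr f; apply: val_inj.
  have [||phi [phiM phiE _]] := @vertex_group_kurosh_extend T f' (fun=> 1).
  + by [].
  + by move=> z Xz; rewrite -[z]/(val (SigSub (mem_set Xz) : X)) f'E; apply: fM.
  exists phi; split; first exact: mulonS vertex_meetsS phiM.
  by move=> x k Mk; rewrite (phiE (val x)) // f'E.
- apply: generated_sub => k [z Xz]; exact: (MA (SigSub (mem_set Xz))).
Qed.

Lemma vertex_group_free_product2 :
  is_internal_free_product2 (V l) vertex_meets vertex_free.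
Proof.
apply: internal_free_productI => [[]|T f fM|A MA].
- exact: vertex_meetsS.
- exact: vertex_freeS.
- have fP : mulon vertex_meets (f true) := fM true.
  have fF : mulon vertex_free (f false) := fM false.
  have [||phi [phiM phiE phiY]] :=
    @vertex_group_kurosh_extend T (fun=> f true) (f false).
  + exact: mulon1 fF.
  + move=> z Xz; apply: mulonS fP => k Mk; apply: sub_generated; by exists z.
  exists phi; split=> // -[].
    apply: generated_eq => //; first exact: mulonS vertex_meetsS phiM.
    by move=> k [z Xz Mk]; apply: phiE Mk.
  by apply: generated_eq => //; apply: mulonS vertex_freeS phiM.
- apply: vertex_group_kurosh_generate => [z Xz k Mk|y Yy].
    by apply: (MA true); apply: sub_generated; exists z.
  by apply: (MA false); apply: sub_generated.
Qed.

End Vertex.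

End Main.

Theorem theorem1p3 (Lambda : Type) (G_ B_ : Lambda -> groupType)
    (G B : groupType)
    (iG : forall l, ghom (G_ l) G) (iB : forall l, ghom (B_ l) B)
    (hG : is_free_product iG) (hB : is_free_product iB)
    (Theta : ghom G B)
    (hTheta : forall l, Theta @` image_group (iG l) = image_group (iB l))
    (H : subgroup G) (hH : Theta @` H = [set: B]) :
  exists (H_ F_ : Lambda -> subgroup G) (X_ : Lambda -> set G),
    (forall l, H_ l `<=` H) /\
    (forall l, F_ l `<=` H_ l /\ is_free_group (sub_of (F_ l))) /\
    (forall l (x : G),
        exists! y, X_ l y /\ double_coset (image_group (iG l)) x H y) /\
    is_internal_free_product H H_ /\
    (forall l, Theta @` H_ l = image_group (iB l)) /\
    (forall l, exists P : subgroup G,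
        is_internal_free_product P
          (fun x : X_ l =>
             meet_group H (conj_group (image_group (iG l)) (val x))) /\
        is_internal_free_product2 (H_ l) P (F_ l)) /\
    (forall l x, X_ l x -> Theta x = 1) /\
    (forall l, X_ l 1).
Proof.
have [D [fD connD]] := spanning_tree_exists hG hB hTheta hH.
exists (vertex_group fD), (vertex_free hG fD), (coset_reps hG fD).
split; first exact: vertex_groupS.
split.
  by move=> l; split; [exact: vertex_freeS|apply: vertex_free_group].
split; first by move=> l x; apply: coset_reps_uniq.
split; first exact: vertex_group_free_product.
split; first by move=> l; apply: vertex_group_image.
split.
  move=> l; exists (vertex_meets hG fD l).
  split; first exact: vertex_meets_free_product.
  exact: vertex_group_free_product2.
split=> l; last exact: (coset_reps1 hG hTheta fD l).
by move=> x Xx; have [] := coset_repsP hTheta Xx.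
Qed.
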